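(* A clause set in set-valued propositional (first-order) logic is satisfiable iff it is consistent under set-valued propositional (first-order) resolution.
   Context: Fix a finite set of agents N and a finite set W. Set-valued first-order logic is interpreted over outcome models M = ((S_j)_{j in N}, f, W, [[-]]), where the S_j are sets (one sort j per agent), [[-]] interprets sorted function symbols as sorted functions on the S_j respecting their sort profiles, and f : (prod_{j in N} S_j) -> W is an outcome function. Terms are built from sorted variables and sorted function symbols; a literal has the form A(t̄) with A ⊆ W and t̄ an N-tuple of terms whose j-th component has sort j. A clause is a finite set of literals (read disjunctively), a clause set a finite set of clauses (read conjunctively). M satisfies A(t̄) under a sort-respecting valuation η if f([[t̄]]η) ∈ A; M satisfies a clause under η if it satisfies some literal of it; M satisfies a clause if it does so under every valuation; a clause set is satisfiable if some outcome model satisfies all its clauses. Clauses are normalized to mention each tuple of terms at most once (A(t̄),B(t̄) becomes (A∪B)(t̄)). The set-valued first-order resolution rule derives from clauses Γ, A_1(t̄_1),…,A_n(t̄_n) and B(ū),Δ (n ≥ 1, variables made disjoint by renaming) the clause Γσ, ((A_1∪…∪A_n)∩B)(ūσ), Δσ, where σ is the most general unifier of t̄_1,…,t̄_n, ū. In set-valued propositional logic, tuples of terms are replaced by elements y of an index set Y, models are functions f : Y -> W, f satisfies A(y) if f(y) ∈ A, and the resolution rule derives Γ, (A∩B)(y), Δ from Γ, A(y) and B(y), Δ (no unification). A clause is blatantly inconsistent if all its literals are of the form ∅(t̄) (resp. ∅(y)); a clause set is inconsistent if a blatantly inconsistent clause can be derived from it by the respective resolution rule, and consistent otherwise.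
   Formalization: The set W is assumed nonempty and the sets S_j of an outcome model are required to be nonempty; without this the claim fails (empty W with the empty clause set; an empty S_j admits no valuation, so even the empty clause would be satisfied). *)

(* Defs.v *)
From HB Require Import structures.
From mathcomp Require Import all_boot finmap.
From mathcomp Require Import boolp.

Set Implicit Arguments.
Unset Strict Implicit.
Unset Printing Implicit Defensive.

Local Open Scope fset_scope.

(* Literals and clauses over an arbitrary type Y of atoms: Y is the index set in
   the propositional case, and the type of N-tuples of terms in the first-order
   case.  The pair (y, A) stands for A(y). *)
Definition literal (Y : choiceType) (W : finType) : choiceType :=
  (Y * {set W})%type.

Definition clause (Y : choiceType) (W : finType) : choiceType :=
  {fset literal Y W}.

Definition clause_set (Y : choiceType) (W : finType) : choiceType :=
  {fset clause Y W}.

(* The union of all sets A with A(y) in C. *)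
Definition merged (Y : choiceType) (W : finType) (C : clause Y W) (y : Y) :
  {set W} := \bigcup_(l <- C | l.1 == y) l.2.

Definition normalize (Y : choiceType) (W : finType) (C : clause Y W) :
  clause Y W := [fset (y, merged C y) | y in [fset l.1 | l in C]].

Definition blatantly_inconsistent (Y : choiceType) (W : finType)
  (C : clause Y W) : Prop := forall l, l \in C -> l.2 = set0.

Definition prop_sat_clause (Y : choiceType) (W : finType) (f : Y -> W)
  (C : clause Y W) : Prop := exists2 l, l \in C & f l.1 \in l.2.

Definition prop_satisfiable (Y : choiceType) (W : finType)
  (Phi : clause_set Y W) : Prop :=
  exists f : Y -> W, forall C, C \in Phi -> prop_sat_clause f C.

Inductive prop_derivable (Y : choiceType) (W : finType)
  (Phi : clause_set Y W) : clause Y W -> Prop :=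
| prop_hyp C : C \in Phi -> prop_derivable Phi (normalize C)
| prop_res (C D : clause Y W) (y : Y) (A B : {set W}) :
    prop_derivable Phi C -> prop_derivable Phi D ->
    (y, A) \in C -> (y, B) \in D ->
    prop_derivable Phi
      (normalize ((C `\ (y, A)) `|` [fset (y, A :&: B)] `|` (D `\ (y, B)))).

Definition prop_consistent (Y : choiceType) (W : finType)
  (Phi : clause_set Y W) : Prop :=
  ~ (exists2 C, prop_derivable Phi C & blatantly_inconsistent C).

Record signature (N : finType) := Signature {
  symbol : Type;
  arity : symbol -> nat;
  arg_sort : forall g : symbol, 'I_(arity g) -> N;
  res_sort : symbol -> N
}.
Arguments arg_sort {N s} g i.

(* The variables of sort j are the Var j x with x : nat. *)
Inductive term (N : finType) (Sg : signature N) : N -> Type :=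
| Var (j : N) (x : nat) : term Sg j
| App (g : symbol Sg) (args : forall i : 'I_(arity g), term Sg (arg_sort g i)) :
    term Sg (res_sort g).
Arguments Var {N} Sg j x.
Arguments App {N Sg} g args.

Definition term_tuple (N : finType) (Sg : signature N) : Type :=
  forall j : N, term Sg j.

HB.instance Definition _ (N : finType) (Sg : signature N) :=
  gen_eqMixin (term_tuple Sg).
HB.instance Definition _ (N : finType) (Sg : signature N) :=
  gen_choiceMixin (term_tuple Sg).

(* Carriers are nonempty, as usual in first-order logic: a model with an empty
   carrier admits no valuation and would satisfy even the empty clause. *)
Record outcome_model (N : finType) (Sg : signature N) (W : finType) :=
  OutcomeModel {
  carrier : N -> Type;
  carrier_nonempty : forall j, inhabited (carrier j);
  interp : forall g : symbol Sg,
    (forall i : 'I_(arity g), carrier (arg_sort g i)) -> carrier (res_sort g);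
  outcome : (forall j, carrier j) -> W
}.
Arguments interp {N Sg W} M g args : rename.

Definition valuation (N : finType) (Sg : signature N) (W : finType)
  (M : outcome_model Sg W) : Type := forall j, nat -> carrier M j.

Fixpoint eval (N : finType) (Sg : signature N) (W : finType)
  (M : outcome_model Sg W) (eta : valuation M) (j : N) (t : term Sg j) :
  carrier M j :=
  match t with
  | Var j x => eta j x
  | App g args => interp M g (fun i => eval eta (args i))
  end.

Definition fo_sat_clause (N : finType) (Sg : signature N) (W : finType)
  (M : outcome_model Sg W) (C : clause (term_tuple Sg) W) : Prop :=
  forall eta : valuation M,
    exists2 l, l \in C & outcome (fun j => eval eta (l.1 j)) \in l.2.

Definition fo_satisfiable (N : finType) (Sg : signature N) (W : finType)
  (Phi : clause_set (term_tuple Sg) W) : Prop :=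
  exists M : outcome_model Sg W, forall C, C \in Phi -> fo_sat_clause M C.

Definition substitution (N : finType) (Sg : signature N) : Type :=
  forall j, nat -> term Sg j.

Fixpoint subst (N : finType) (Sg : signature N) (sigma : substitution Sg)
  (j : N) (t : term Sg j) : term Sg j :=
  match t with
  | Var j x => sigma j x
  | App g args => App g (fun i => subst sigma (args i))
  end.

Definition subst_tuple (N : finType) (Sg : signature N)
  (sigma : substitution Sg) (t : term_tuple Sg) : term_tuple Sg :=
  fun j => subst sigma (t j).

Definition subst_clause (N : finType) (Sg : signature N) (W : finType)
  (sigma : substitution Sg) (C : clause (term_tuple Sg) W) :
  clause (term_tuple Sg) W := [fset (subst_tuple sigma l.1, l.2) | l in C].

Definition is_renaming (N : finType) (rho : N -> nat -> nat) : Prop :=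
  forall j, injective (rho j).

Definition rename_clause (N : finType) (Sg : signature N) (W : finType)
  (rho : N -> nat -> nat) (C : clause (term_tuple Sg) W) :
  clause (term_tuple Sg) W := subst_clause (fun j x => Var Sg j (rho j x)) C.

Fixpoint occurs (N : finType) (Sg : signature N) (k : N) (x : nat) (j : N)
  (t : term Sg j) : Prop :=
  match t with
  | Var j y => j = k /\ y = x
  | App g args => exists i, occurs k x (args i)
  end.

Definition occurs_clause (N : finType) (Sg : signature N) (W : finType)
  (k : N) (x : nat) (C : clause (term_tuple Sg) W) : Prop :=
  exists2 l, l \in C & exists j, occurs k x (l.1 j).

Definition var_disjoint (N : finType) (Sg : signature N) (W : finType)
  (C D : clause (term_tuple Sg) W) : Prop :=
  forall k x, ~ (occurs_clause k x C /\ occurs_clause k x D).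

Definition unifies (N : finType) (Sg : signature N) (sigma : substitution Sg)
  (E : {fset term_tuple Sg}) : Prop :=
  forall t u, t \in E -> u \in E -> subst_tuple sigma t = subst_tuple sigma u.

Definition is_mgu (N : finType) (Sg : signature N) (sigma : substitution Sg)
  (E : {fset term_tuple Sg}) : Prop :=
  unifies sigma E /\
  forall tau : substitution Sg, unifies tau E ->
    exists delta : substitution Sg,
      forall j x, tau j x = subst delta (sigma j x).

(* L is the set of the resolved literals A_1(t_1), ..., A_n(t_n) of the left
   premise. *)
Definition fo_resolvent (N : finType) (Sg : signature N) (W : finType)
  (C L : clause (term_tuple Sg) W) (D : clause (term_tuple Sg) W)
  (u : term_tuple Sg) (B : {set W}) (sigma : substitution Sg) :
  clause (term_tuple Sg) W :=
  normalize
    (subst_clause sigma (C `\` L)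
     `|` [fset (subst_tuple sigma u, (\bigcup_(l <- L) l.2) :&: B)]
     `|` subst_clause sigma (D `\ (u, B))).

Inductive fo_derivable (N : finType) (Sg : signature N) (W : finType)
  (Phi : clause_set (term_tuple Sg) W) : clause (term_tuple Sg) W -> Prop :=
| fo_hyp C : C \in Phi -> fo_derivable Phi (normalize C)
| fo_res (C0 D0 C D L : clause (term_tuple Sg) W) (rho rho' : N -> nat -> nat)
    (u : term_tuple Sg) (B : {set W}) (sigma : substitution Sg) :
    fo_derivable Phi C0 -> fo_derivable Phi D0 ->
    is_renaming rho -> C = rename_clause rho C0 ->
    is_renaming rho' -> D = rename_clause rho' D0 ->
    var_disjoint C D ->
    L `<=` C -> L != fset0 -> (u, B) \in D ->
    is_mgu sigma (u |` [fset l.1 | l in L]) ->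
    fo_derivable Phi (fo_resolvent C L D u B sigma).

Definition fo_consistent (N : finType) (Sg : signature N) (W : finType)
  (Phi : clause_set (term_tuple Sg) W) : Prop :=
  ~ (exists2 C, fo_derivable Phi C & blatantly_inconsistent C).

(* Main.v *)
Require Import Defs.
From mathcomp Require Import all_boot finmap.
From mathcomp Require Import boolp.
From mathcomp Require classical_sets.

Set Implicit Arguments.
Unset Strict Implicit.
Unset Printing Implicit Defensive.

Local Open Scope fset_scope.

(* Soundness is immediate: resolution preserves satisfaction in every model.
   For completeness, take a resolution-closed set S of clauses over atoms Y
   without blatantly inconsistent members, and, by Zorn's lemma, a pointwise
   minimal F : Y -> {set W} such that each clause of S has a literal A(y) with
   A meeting F y. Chains have infima because W and all clauses are finite, and
   minimality together with one resolution step shows that each F y has at most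
   one element, so F yields a model. This covers infinite S and thus needs no
   separate compactness argument.
   In the first-order case, S consists of all substitution instances of the
   derivable clauses and the model is the term model. Resolution steps between
   instances lift to first-order ones through most general unifiers. These are
   obtained without a unification algorithm: call two terms equivalent if all
   unifiers identify them, and replace hereditarily each term by a fixed
   representative of its class, one headed by a function symbol if possible.
   This terminates as one given unifier bounds the depth. *)

(** Normalization changes literals but not the allowed pairs, so clauses are compared below through
    these pairs. *)
Definition allows (Y : choiceType) (W : finType) (C : clause Y W) (y : Y)
  (w : W) : Prop := exists2 A : {set W}, (y, A) \in C & w \in A.

Lemma mem_bigcup_seq (I : eqType) (W : finType) (s : seq I) (P : pred I)
    (F : I -> {set W}) (w : W) :
  w \in (\bigcup_(i <- s | P i) F i)%SET <->
  exists i, [/\ i \in s, P i & w \in F i].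
Proof.
elim: s => [|i s IH].
  by rewrite big_nil inE; split => // -[? []].
rewrite big_cons; split.
  case: ifPn => Pi.
    rewrite inE => /orP[wi|/IH[k [ks Pk wk]]].
      by exists i; rewrite inE eqxx.
    by exists k; rewrite inE ks orbT.
  by move=> /IH[k [ks Pk wk]]; exists k; rewrite inE ks orbT.
move=> [k []]; rewrite inE => /orP[/eqP->|ks] Pk wk.
  by rewrite Pk inE wk.
have wU : w \in (\bigcup_(j <- s | P j) F j)%SET by apply/IH; exists k.
by case: ifP; rewrite // inE wU orbT.
Qed.

Lemma mem_merged (Y : choiceType) (W : finType) (C : clause Y W) (y : Y)
    (w : W) : w \in merged C y <-> allows C y w.
Proof.
rewrite /merged mem_bigcup_seq; split.
  by move=> [[z A] [/= zC /eqP <- wA]]; exists A.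
by move=> [A yA wA]; exists (y, A); split=> //=.
Qed.

Lemma mem_normalize (Y : choiceType) (W : finType) (C : clause Y W) (y : Y)
    (A : {set W}) :
  (y, A) \in normalize C <->
  A = merged C y /\ exists B, (y, B) \in C.
Proof.
split.
  move=> /imfsetP[z /= /imfsetP[[u B] /= uB ->] [-> ->]].
  by split=> //; exists B.
move=> [-> [B yB]]; apply/imfsetP; exists y => //=.
by apply/imfsetP; exists (y, B).
Qed.

Lemma allows_normalize (Y : choiceType) (W : finType) (C : clause Y W) (y : Y)
    (w : W) : allows (normalize C) y w <-> allows C y w.
Proof.
split; first by move=> [A /mem_normalize[-> _] /mem_merged].
move=> yw; have [B yB wB] := yw.
exists (merged C y); first by apply/mem_normalize; split=> //; exists B.
exact/mem_merged.
Qed.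

Lemma blatantly_inconsistentP (Y : choiceType) (W : finType) (C : clause Y W) :
  blatantly_inconsistent C <-> forall y w, ~ allows C y w.
Proof.
split=> [bC y w [A /bC/= -> ]|nC [y A] yA /=]; first by rewrite inE.
apply/setP => w; rewrite inE; apply/negP => wA.
by apply: (nC y w); exists A.
Qed.

Lemma prop_sat_clauseP (Y : choiceType) (W : finType) (f : Y -> W)
    (C : clause Y W) : prop_sat_clause f C <-> exists y, allows C y (f y).
Proof.
split; first by move=> [[y A] /= yA fA]; exists y, A.
by move=> [y [A yA fA]]; exists (y, A).
Qed.

(** * Model existence *)

Section ModelExistence.
Variables (Y : choiceType) (W : finType) (S : clause Y W -> Prop).

Definition feasible (F : Y -> {set W}) : Prop :=
  forall C, S C -> exists y w, allows C y w /\ w \in F y.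

Definition chain (A : (Y -> {set W}) -> Prop) : Prop :=
  forall F G, A F -> A G ->
    (forall y, F y \subset G y) \/ (forall y, G y \subset F y).

Definition chain_inf (A : (Y -> {set W}) -> Prop) (y : Y) : {set W} :=
  [set w | `[< forall F, A F -> w \in F y >]].

(* W is finite, so the values of a chain at a point stabilize. *)
Lemma chain_inf_attained_at A (y : Y) : chain A -> (exists F, A F) ->
  exists2 F, A F & F y \subset chain_inf A y.
Proof.
move=> chA [F0 AF0].
have ex : exists n, `[< exists2 F, A F & #|F y| = n >].
  by exists #|F0 y|; apply/asboolP; exists F0.
case: (ex_minnP ex) => n /asboolP[F AF <-] minF.
exists F => //; apply/subsetP => w wF; rewrite inE; apply/asboolP => G AG.
have [FG|GF] := chA F G AF AG; first exact: (subsetP (FG y)).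
suff -> : G y = F y by [].
apply/eqP; rewrite eqEcard GF /=; apply: minF.
by apply/asboolP; exists G.
Qed.

(** For finitely many atoms, such as those of one clause, a single member of the chain suffices: at
    each new atom, keep the smaller of two comparable members. *)
Lemma chain_inf_attained A (s : seq Y) : chain A -> (exists F, A F) ->
  exists2 F, A F & forall y, y \in s -> F y \subset chain_inf A y.
Proof.
move=> chA neA; elim: s => [|y s [F AF Fs]].
  by have [F AF] := neA; exists F.
have [G AG Gy] := chain_inf_attained_at y chA neA.
have [FG|GF] := chA F G AF AG.
  exists F => // z; rewrite inE => /orP[/eqP->|/Fs//].
  exact: subset_trans (FG y) Gy.
exists G => // z; rewrite inE => /orP[/eqP->//|/Fs].
exact: subset_trans (GF z).
Qed.

Lemma feasible_chain_inf A : chain A -> (exists F, A F) ->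
  (forall F, A F -> feasible F) -> feasible (chain_inf A).
Proof.
move=> chA neA fA C SC.
have [F AF FC] := chain_inf_attained [seq l.1 | l <- C] chA neA.
have [y [w [[B yB wB] wF]]] := fA F AF C SC.
exists y, w; split; first by exists B.
by apply: (subsetP (FC y _)) => //; apply/mapP; exists (y, B).
Qed.

Lemma minimal_feasible : feasible (fun=> setT) ->
  exists2 F, feasible F &
    forall G, feasible G -> (forall y, G y \subset F y) ->
      forall y, F y \subset G y.
Proof.
move=> fT.
pose T := {F : Y -> {set W} | feasible F}.
(* Inclusion is reversed, so that maximal elements for [R] are pointwise minimal. *)
pose R (F G : T) := `[< forall y, sval G y \subset sval F y >].
have := @classical_sets.ZL_preorder T (exist _ _ fT) R.
case.
- by move=> F; apply/asboolP.
- move=> F G H /asboolP GF /asboolP HG; apply/asboolP => y.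
  exact: subset_trans (HG y) (GF y).
- move=> A totA; have [neA|eA] := pselect (exists F, A F); last first.
    by exists (exist _ _ fT) => F AF; case: eA; exists F.
  pose A' (F : Y -> {set W}) := exists2 f : T, A f & F = sval f.
  have chA' : chain A'.
    move=> _ _ [F AF ->] [G AG ->].
    by have [/asboolP|/asboolP] := totA F G AF AG; [right|left].
  have neA' : exists F, A' F by have [F AF] := neA; exists (sval F), F.
  have fA' F : A' F -> feasible F by move=> [f _ ->]; exact: svalP.
  exists (exist _ _ (feasible_chain_inf chA' neA' fA')) => F AF.
  apply/asboolP => y /=; apply/subsetP => w; rewrite inE => /asboolP; apply.
  by exists F.
- move=> [F fF] maxF; exists F => // G fG GF.
  by have /asboolP := maxF (exist _ G fG) (introT (asboolP _) GF).
Qed.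

(* In a minimal feasible F every F y has at most one element: if w and w'
   were two of them, removing either would break a clause of S, and resolving
   the two broken clauses at y would give a clause broken by F itself. *)
Lemma model_existence (w0 : W) :
  (forall C, S C -> ~ blatantly_inconsistent C) ->
  (forall C D y, S C -> S D -> exists2 E, S E &
     (forall z w, z <> y -> allows E z w -> allows C z w \/ allows D z w) /\
     (forall w, allows E y w -> allows C y w /\ allows D y w)) ->
  exists f : Y -> W, forall C, S C -> exists y, allows C y (f y).
Proof.
move=> consS resS.
have [C SC|F fF minF] := minimal_feasible.
  have nC := consS C SC; apply: contrapT => nex; apply: nC.
  by apply/blatantly_inconsistentP => y w yw; apply: nex; exists y, w.
have brk y w : w \in F y -> exists2 C, S C &
    forall z v, allows C z v -> v \in F z -> z = y /\ v = w.
  move=> wF; pose G z := if z == y then F z :\ w else F z.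
  have GF z : G z \subset F z.
    by rewrite /G; case: eqP => // _; exact: subsetDl.
  have /existsNP[C /not_implyP[SC nC]] : ~ feasible G.
    move=> fG; have /subsetP/(_ w wF) := minF G fG GF y.
    by rewrite /G eqxx !inE eqxx.
  exists C => // z v zv vF; apply: contrapT => ne; apply: nC.
  exists z, v; split=> //; rewrite /G; case: eqP => // zy.
  by rewrite !inE vF andbT; apply/eqP => vw; apply: ne.
have sgl y w w' : w \in F y -> w' \in F y -> w = w'.
  move=> wF wF'; have [C SC Cy] := brk y w wF; have [D SD Dy] := brk y w' wF'.
  have [E SE [Ez Ey]] := resS C D y SC SD.
  have [z [v [zv vF]]] := fF E SE.
  have [zy|zy] := pselect (z = y); last first.
    by case: (Ez z v zy zv) => [/Cy/(_ vF)|/Dy/(_ vF)] [].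
  subst z; have [/Cy/(_ vF)[_ <-] /Dy/(_ vF)[_ <-]] := Ey v zv; by [].
(* The default [w0] is taken only where [F y] is empty, never at the atom that witnesses feasibility
   for [C]. *)
exists (fun y => odflt w0 [pick w in F y]) => C SC.
have [y [w [yw wF]]] := fF C SC; exists y.
case: pickP => [v vF|/(_ w)]; last by rewrite wF.
by rewrite /= (sgl y v w vF wF).
Qed.

End ModelExistence.

(** * Propositional resolution *)

Lemma in_fsetD1_fset1_fsetD1 (K : choiceType) (C D : {fset K}) (a b c x : K) :
  (x \in (C `\ a) `|` [fset c] `|` (D `\ b)) =
  [|| (x != a) && (x \in C), x == c | (x != b) && (x \in D)].
Proof. by rewrite !inE -orbA. Qed.

(** A true literal of a premise survives unless it is resolved upon; if both true literals are, then
    [f y] lies in [A :&: B]. *)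
Lemma prop_sound (Y : choiceType) (W : finType) (Phi : clause_set Y W)
    (f : Y -> W) : (forall C, C \in Phi -> prop_sat_clause f C) ->
  forall C, prop_derivable Phi C -> exists y, allows C y (f y).
Proof.
move=> fPhi C; elim=> {C} [C CPhi|C D y A B _ [z [A' zA fA]] _
    [z' [B' zB fB]] yA yB].
  have [y yC] := (prop_sat_clauseP f C).1 (fPhi C CPhi).
  by exists y; apply/allows_normalize.
have [eA|nA] := eqVneq (z, A') (y, A); last first.
  exists z; apply/allows_normalize; exists A' => //.
  by rewrite in_fsetD1_fset1_fsetD1 nA zA.
have [eB|nB] := eqVneq (z', B') (y, B); last first.
  exists z'; apply/allows_normalize; exists B' => //.
  by rewrite in_fsetD1_fset1_fsetD1 nB zB !orbT.
case: eA eB => ? ? [? ?]; subst.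
exists y; apply/allows_normalize; exists (A :&: B); last by rewrite inE fA.
by rewrite in_fsetD1_fset1_fsetD1 eqxx orbT.
Qed.

(** Derivable clauses are normal forms. Hence removing the resolved literal removes all that a
    premise allows at [y]. *)
Lemma prop_derivable_functional (Y : choiceType) (W : finType)
    (Phi : clause_set Y W) C (y : Y) (A B : {set W}) :
  prop_derivable Phi C -> (y, A) \in C -> (y, B) \in C -> A = B.
Proof.
by case=> {C} [C _|C D z A' B' _ _ _ _]; move=> /mem_normalize[-> _]
  /mem_normalize[-> _].
Qed.

Lemma prop_satisfiable_iff_consistent (Y : choiceType) (W : finType) (w0 : W)
    (Phi : clause_set Y W) : prop_satisfiable Phi <-> prop_consistent Phi.
Proof.
split=> [[f fPhi] [C dC /blatantly_inconsistentP nC]|consPhi].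
  by have [y /nC] := prop_sound fPhi dC.
have [C dC bC|C D y dC dD|f fS] :=
    @model_existence Y W (prop_derivable Phi) w0.
- by apply: consPhi; exists C.
(* A premise that does not mention [y] allows nothing there and can itself serve as [E]. *)
- have [[A yA]|nC] := pselect (exists A, (y, A) \in C); last first.
    exists C => //; split=> [z w _|w [A yA]]; first by left.
    by case: nC; exists A.
  have [[B yB]|nD] := pselect (exists B, (y, B) \in D); last first.
    exists D => //; split=> [z w _|w [B yB]]; first by right.
    by case: nD; exists B.
  eexists; first exact: prop_res dC dD yA yB.
  split=> [z w zy|w] /allows_normalize[X]; rewrite in_fsetD1_fset1_fsetD1;
      move=> /or3P[/andP[nX XC]|/eqP eX|/andP[nX XD]] wX.
  + by left; exists X.
  + by case: zy; case: eX.
  + by right; exists X.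
  + by case/eqP: nX; rewrite (prop_derivable_functional dC XC yA).
  + move: wX; case: eX => ->; rewrite inE => /andP[wA wB].
    by split; [exists A|exists B].
  + by case/eqP: nX; rewrite (prop_derivable_functional dD XD yB).
- exists f => C CPhi; apply/prop_sat_clauseP.
  have [y /allows_normalize yC] := fS _ (prop_hyp CPhi).
  by exists y.
Qed.

(** * Most general unifiers *)

Section Terms.
Variables (N : finType) (Sg : signature N).

Fixpoint depth (j : N) (t : term Sg j) : nat :=
  match t with
  | Var _ _ => 1
  | App g args => (\max_i depth (args i)).+1
  end.

(** The result type does not depend on the sort [j], so heads of terms can be compared without
    transport along equalities of sorts. *)
Definition decomp (j : N) (t : term Sg j) :
  option {g : symbol Sg & forall i : 'I_(arity g), term Sg (arg_sort g i)} :=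
  match t with
  | Var _ _ => None
  | App g args => Some (existT _ g args)
  end.

Lemma existT_inj (T : Type) (P : T -> Type) (x : T) (a b : P x) :
  existT P x a = existT P x b -> a = b.
Proof.
move=> e; have := projT2_eq e.
by rewrite (Prop_irrelevance (projT1_eq e) erefl).
Qed.

Lemma App_inj (g : symbol Sg) args args' : App g args = App g args' ->
  args = args'.
Proof. by move=> /(congr1 (@decomp _)) e; exact: existT_inj (Some_inj e). Qed.

Lemma decomp_App (g : symbol Sg) args (t : term Sg (res_sort g)) :
  decomp t = Some (existT _ g args) -> t = App g args.
Proof.
suff gen j (u : term Sg j) (e : j = res_sort g) :
    decomp u = Some (existT _ g args) ->
    eq_rect j (term Sg) u (res_sort g) e = App g args by exact: (gen _ t erefl).
case: j / u e => [//|h a] e /Some_inj eha.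
have /= eh := projT1_eq eha; subst h; rewrite (existT_inj eha).
by rewrite (Prop_irrelevance e erefl).
Qed.

Lemma decomp_subst (tau : substitution Sg) j (t : term Sg j) g args :
  decomp t = Some (existT _ g args) ->
  decomp (subst tau t) = Some (existT _ g (fun i => subst tau (args i))).
Proof.
case: j / t => [//|h a] /Some_inj eha.
by have /= eh := projT1_eq eha; subst h; rewrite (existT_inj eha).
Qed.

Lemma subst_subst (sigma tau : substitution Sg) j (t : term Sg j) :
  subst tau (subst sigma t) = subst (fun k x => subst tau (sigma k x)) t.
Proof.
elim: t => [//|g args IH] /=; congr App.
by apply: functional_extensionality_dep.
Qed.

Lemma subst_tuple_comp (sigma tau : substitution Sg) (t : term_tuple Sg) :
  subst_tuple tau (subst_tuple sigma t) =
  subst_tuple (fun k x => subst tau (sigma k x)) t.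
Proof. by apply: functional_extensionality_dep => j; exact: subst_subst. Qed.

Variable E : {fset term_tuple Sg}.

Definition forced (j : N) (t u : term Sg j) : Prop :=
  forall tau, unifies tau E -> subst tau t = subst tau u.

Definition class_head (j : N) (t u : term Sg j) : Prop :=
  forced t u /\ (decomp u = None -> forall v, forced t v -> decomp v = None).

Lemma class_head_ex j (t : term Sg j) : exists u, class_head t u.
Proof.
have [[u [tu uA]]|nA] := pselect (exists u, forced t u /\ decomp u <> None).
  by exists u; split=> // /uA.
exists t; split=> // _ v tv; apply: contrapT => vA.
by apply: nA; exists v.
Qed.

Definition rep (j : N) (t : term Sg j) : term Sg j :=
  sval (cid (class_head_ex t)).

Lemma repP j (t : term Sg j) : class_head t (rep t).
Proof. exact: svalP. Qed.

(** The choice depends only on the predicate [class_head t], which is the same for equivalent terms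
    by extensionality. *)
Lemma eq_rep j (t u : term Sg j) : forced t u -> rep t = rep u.
Proof.
move=> tu; rewrite /rep.
move: (class_head_ex t) (class_head_ex u).
have -> : class_head t = class_head u.
  have tuv v : forced t v <-> forced u v.
    by split=> h tau utau; rewrite -h // tu.
  apply: funext => v; apply: propext; split=> -[/tuv tv h]; split=> //.
    by move=> /h{}h w /tuv; exact: h.
  by move=> /h{}h w /tuv; exact: h.
by move=> p q; rewrite (Prop_irrelevance p q).
Qed.

(* The first argument is recursion fuel; [depth (subst tau t)], for any unifier
   [tau] of E, is enough of it. *)
Fixpoint nf (n : nat) (j : N) (t : term Sg j) : term Sg j :=
  if n is m.+1 then
    match rep t in term _ k return term Sg k with
    | Var k x => Var Sg k x
    | App g args => App g (fun i => nf m (args i))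
    end
  else t.

(** Representatives are identified with their terms by every unifier, whatever the fuel; this makes
    [mgu] most general. *)
Lemma subst_nf tau n j (t : term Sg j) : unifies tau E ->
  subst tau (nf n t) = subst tau t.
Proof.
move=> utau; elim: n j t => [//|n IH] j t /=.
have [/(_ tau utau) -> _] := repP t.
move: (rep t) => {t} r; case: j / r => [//|g args] /=; congr App.
by apply: functional_extensionality_dep => i; exact: IH.
Qed.

Variables (tau0 : substitution Sg) (utau0 : unifies tau0 E).

Lemma depth_gt0 j (t : term Sg j) : 0 < depth t.
Proof. by case: t. Qed.

Lemma depth_arg (g : symbol Sg) args (i : 'I_(arity g)) :
  depth (args i) < depth (App g args).
Proof. by rewrite /= ltnS (leq_bigmax i). Qed.

(** [tau0] gives [rep t] and [t] the same instance, so the depth measured under [tau0] drops at each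
    argument. *)
Lemma nf_fuel n m j (t : term Sg j) : depth (subst tau0 t) <= n ->
  depth (subst tau0 t) <= m -> nf n t = nf m t.
Proof.
elim: n m j t => [|n IH] [|m] j t; try by rewrite leqNgt depth_gt0.
  by move=> _; rewrite leqNgt depth_gt0.
have [/(_ tau0 utau0) -> _] := repP t.
rewrite /=; move: (rep t) => {t} r; case: j / r => [//|g args] dn dm; congr App.
apply: functional_extensionality_dep => i; apply: IH.
  by rewrite -ltnS; apply: leq_trans dn; exact: depth_arg.
by rewrite -ltnS; apply: leq_trans dm; exact: depth_arg.
Qed.

Definition mgu : substitution Sg :=
  fun j x => nf (depth (tau0 j x)) (Var Sg j x).

Lemma eq_nf n j (t u : term Sg j) : 0 < n -> forced t u -> nf n t = nf n u.
Proof. by case: n => // n _ /eq_rep /= ->. Qed.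

(** The class contains a compound term, so its representative is compound. The unifier [tau0] forces
    the head to be [g], and injectivity of [App] under every unifier makes the arguments
    equivalent. *)
Lemma rep_App (g : symbol Sg) args : exists2 args',
  rep (App g args) = App g args' & forall i, forced (args i) (args' i).
Proof.
have [fr hr] := repP (App g args); move: fr hr; set r := rep _ => fr hr.
case dr: (decomp r) => [[h b]|]; last by have := hr dr _ (fun=> fun=> erefl).
have := decomp_subst tau0 dr; rewrite -fr //= => /Some_inj eab.
have /= eh := projT1_eq eab; subst h.
have er := decomp_App dr; exists b => // i tau utau.
by have := fr tau utau; rewrite er => /App_inj/(congr1 (fun f => f i)).
Qed.

(** Normalizing the variables normalizes the whole term: by [rep_App] the arguments of the
    representative are equivalent to the original ones, and equivalent terms share their normal
    form. *)
Lemma subst_mgu n j (t : term Sg j) : depth (subst tau0 t) <= n ->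
  subst mgu t = nf n t.
Proof.
elim: t n => [k x|g args IH] n dt /=; first exact: nf_fuel.
case: n dt => [//|n] dt /=.
have [args' -> aa'] := rep_App args; congr App.
apply: functional_extensionality_dep => i.
have di : depth (subst tau0 (args i)) <= n.
  rewrite -ltnS; apply: leq_trans dt.
  exact: (@depth_arg g (fun i => subst tau0 (args i))).
rewrite (IH i n di); apply: eq_nf => //.
by apply: leq_trans di; exact: depth_gt0.
Qed.

Lemma mguP : is_mgu mgu E.
Proof.
split=> [t u tE uE|tau utau].
  apply: functional_extensionality_dep => j; rewrite /subst_tuple.
  have tu : forced (t j) (u j).
    by move=> tau /(_ t u tE uE)/(congr1 (fun f => f j)).
  (* The same fuel serves both terms, as [tau0] makes them equal. *)
  rewrite (subst_mgu (leqnn _)) (@subst_mgu (depth (subst tau0 (t j)))).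
    by apply: eq_nf => //; exact: depth_gt0.
  by rewrite tu.
(* Each unifier factors through [mgu] with itself as second factor. *)
by exists tau => j x; rewrite /mgu subst_nf.
Qed.

End Terms.

(** * First-order resolution *)

Section FirstOrder.
Variables (N W : finType) (Sg : signature N).
Implicit Types (C D : clause (term_tuple Sg) W) (sigma tau : substitution Sg).

Lemma mem_subst_clause sigma C v (A : {set W}) :
  (v, A) \in subst_clause sigma C <->
  exists2 u, (u, A) \in C & v = subst_tuple sigma u.
Proof.
split; first by move=> /imfsetP[[u B] /= uB [-> ->]]; exists u.
by move=> [u uA ->]; apply/imfsetP; exists (u, A).
Qed.

Lemma allows_subst sigma C z (w : W) :
  allows (subst_clause sigma C) z w <->
  exists2 v, allows C v w & z = subst_tuple sigma v.
Proof.
split.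
  by move=> [A /mem_subst_clause[v vA ->] wA]; exists v => //; exists A.
move=> [v [A vA wA] ->]; exists A => //.
by apply/mem_subst_clause; exists v.
Qed.

(** * Evaluation under substitutions and soundness *)

Lemma eval_subst (M : outcome_model Sg W) (eta : valuation M) sigma j
    (t : term Sg j) :
  eval eta (subst sigma t) = eval (fun k x => eval eta (sigma k x)) t.
Proof.
elim: t => [//|g args IH] /=; congr (interp M g _).
exact: functional_extensionality_dep.
Qed.

Lemma fo_sat_clauseP (M : outcome_model Sg W) C :
  fo_sat_clause M C <-> forall eta : valuation M,
    exists v, allows C v (outcome (fun j => eval eta (v j))).
Proof.
split=> sC eta; have := sC eta.
  by move=> [[v A] vA fA]; exists v, A.
by move=> [v [A vA fA]]; exists (v, A).
Qed.

Lemma fo_sat_subst (M : outcome_model Sg W) sigma C :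
  fo_sat_clause M C -> fo_sat_clause M (subst_clause sigma C).
Proof.
move=> /fo_sat_clauseP sC; apply/fo_sat_clauseP => eta.
have [v vC] := sC (fun k x => eval eta (sigma k x)).
exists (subst_tuple sigma v); apply/allows_subst; exists v => //.
move: vC; congr (allows C v (outcome _)).
by apply: functional_extensionality_dep => j; rewrite eval_subst.
Qed.

Lemma fo_sat_normalize (M : outcome_model Sg W) C :
  fo_sat_clause M C -> fo_sat_clause M (normalize C).
Proof.
move=> /fo_sat_clauseP sC; apply/fo_sat_clauseP => eta.
by have [v vC] := sC eta; exists v; apply/allows_normalize.
Qed.

Lemma fo_sat_resolvent (M : outcome_model Sg W) C D
    (L : clause (term_tuple Sg) W) u (B : {set W}) sigma :
  fo_sat_clause M C -> fo_sat_clause M D ->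
  unifies sigma (u |` [fset l.1 | l in L]) ->
  fo_sat_clause M (fo_resolvent C L D u B sigma).
Proof.
move=> sC sD uni; apply: fo_sat_normalize => eta.
(* Both premises are evaluated under [sigma] followed by [eta], where all unified tuples take the
   same value. *)
pose eta' k x := eval eta (sigma k x).
have evE v : (fun j => eval eta (subst_tuple sigma v j)) =
    fun j => eval eta' (v j).
  by apply: functional_extensionality_dep => j; rewrite eval_subst.
have [[v A] vA fA] := sC eta'; have [[v' B'] vB fB] := sD eta'.
have [vL|nL] := boolP ((v, A) \in L); last first.
  exists (subst_tuple sigma v, A); rewrite /= ?evE // !inE.
  apply/orP; left; apply/orP; left; apply/mem_subst_clause; exists v => //.
  by rewrite !inE nL vA.
have [[eu eB]|nB] := eqVneq (v', B') (u, B); last first.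
  exists (subst_tuple sigma v', B'); rewrite /= ?evE // !inE.
  apply/orP; right; apply/mem_subst_clause; exists v' => //.
  by rewrite !inE nB vB.
subst v' B'; exists (subst_tuple sigma u, (\bigcup_(l <- L) l.2) :&: B)%SET.
  by rewrite !inE eqxx orbT.
rewrite /= evE inE fB andbT; apply/mem_bigcup_seq.
exists (v, A); split=> //=; rewrite -evE (uni u v) ?evE ?fset1U1 //.
by apply: fset1Ur; apply/imfsetP; exists (v, A).
Qed.

Lemma fo_sound (M : outcome_model Sg W) (Phi : clause_set (term_tuple Sg) W) :
  (forall C, C \in Phi -> fo_sat_clause M C) ->
  forall C, fo_derivable Phi C -> fo_sat_clause M C.
Proof.
move=> sPhi C; elim=> {C} [C /sPhi|C0 D0 C D L rho rho' u B sigma _ sC0 _ sD0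
    _ -> _ -> _ _ _ _ [uni _]]; first exact: fo_sat_normalize.
by apply: fo_sat_resolvent => //; exact: fo_sat_subst.
Qed.

Lemma valuation_ex (M : outcome_model Sg W) : exists eta : valuation M, True.
Proof.
have pt j : {x : carrier M j | True}.
  by apply: cid; have [x] := carrier_nonempty M j; exists x.
by exists (fun j _ => sval (pt j)).
Qed.

(** * Renaming the premises apart *)

Lemma occurs_rename (rho : N -> nat -> nat) k x j (t : term Sg j) :
  occurs k x (subst (fun j y => Var Sg j (rho j y)) t) ->
  exists y, x = rho k y.
Proof.
elim: t => [i y /= [<- <-]|g args IH /= [i /IH //]]; by exists y.
Qed.

(** Left premises receive even variables and right premises odd ones, so two arbitrary substitutions
    combine into one, [interleave]. *)
Definition even_ren : N -> nat -> nat := fun _ x => x.*2.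
Definition odd_ren : N -> nat -> nat := fun _ x => x.*2.+1.

Definition interleave tau tau' : substitution Sg :=
  fun j x => if odd x then tau' j x./2 else tau j x./2.

Lemma even_renP : is_renaming even_ren.
Proof. by move=> j x y /double_inj. Qed.

Lemma odd_renP : is_renaming odd_ren.
Proof. by move=> j x y [] /double_inj. Qed.

Lemma var_disjoint_ren C D :
  var_disjoint (rename_clause even_ren C) (rename_clause odd_ren D).
Proof.
move=> k x [[[v A] /mem_subst_clause[u _ ->] [j /occurs_rename[y ->]]]].
move=> [[v' B] /mem_subst_clause[u' _ ->] [j' /occurs_rename[y']]].
by move/(congr1 odd); rewrite /even_ren /odd_ren /= !odd_double.
Qed.

Lemma interleave_even tau tau' (v : term_tuple Sg) :
  subst_tuple (interleave tau tau')
    (subst_tuple (fun j x => Var Sg j (even_ren j x)) v) = subst_tuple tau v.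
Proof.
rewrite subst_tuple_comp; congr subst_tuple.
apply: functional_extensionality_dep => j; apply: funext => x.
by rewrite /= /interleave /even_ren odd_double doubleK.
Qed.

Lemma interleave_odd tau tau' (v : term_tuple Sg) :
  subst_tuple (interleave tau tau')
    (subst_tuple (fun j x => Var Sg j (odd_ren j x)) v) = subst_tuple tau' v.
Proof.
rewrite subst_tuple_comp; congr subst_tuple.
apply: functional_extensionality_dep => j; apply: funext => x.
by rewrite /= /interleave /odd_ren /= odd_double /= uphalf_double.
Qed.

(** * Lifting resolution between instances *)

Variable Phi : clause_set (term_tuple Sg) W.

(** [phi] is the renaming of [D] followed by the most general unifier, and [delta] is the factor
    that recovers the given instances. [R] is kept unnormalized so that each of its literals can be
    traced to a premise. *)
Lemma lift_resolution C D tau tau' y u (B : {set W}) :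
  fo_derivable Phi C -> fo_derivable Phi D ->
  (exists v A, (v, A) \in C /\ subst_tuple tau v = y) ->
  (u, B) \in D -> subst_tuple tau' u = y ->
  exists R delta phi, [/\ fo_derivable Phi (normalize R),
    forall v, subst_tuple delta (subst_tuple phi v) = subst_tuple tau' v &
    forall v X, (v, X) \in R ->
    [\/ exists v0, [/\ (v0, X) \in C, subst_tuple tau v0 <> y &
          subst_tuple delta v = subst_tuple tau v0],
        [/\ subst_tuple delta v = y, X \subset merged (subst_clause tau C) y &
          X \subset B] |
        exists v0, [/\ (v0, X) \in D, (v0, X) <> (u, B) &
          v = subst_tuple phi v0]]].
Proof.
move=> dC dD [v1 [A1 [vC vy]]] uD uy.
pose re j x := Var Sg j (even_ren j x); pose ro j x := Var Sg j (odd_ren j x).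
pose C' := rename_clause even_ren C; pose D' := rename_clause odd_ren D.
pose th := interleave tau tau'.
(* All literals of [C] with instance [y] are resolved at once, so none of them survives at [y]. *)
pose L : clause (term_tuple Sg) W :=
  [fset l in C' | subst_tuple th l.1 == y].
pose u' := subst_tuple ro u.
have memL v A : (v, A) \in L = ((v, A) \in C') && (subst_tuple th v == y).
  by rewrite !inE.
have u'D : (u', B) \in D' by apply/mem_subst_clause; exists u.
have LC : L `<=` C' by apply/fsubsetP => -[v A]; rewrite memL => /andP[].
have nL : L != fset0.
  apply/fset0Pn; exists (subst_tuple re v1, A1); rewrite memL.
  apply/andP; split; first by apply/mem_subst_clause; exists v1.
  by rewrite interleave_even vy.
have thy v : v \in u' |` [fset l.1 | l in L] -> subst_tuple th v = y.
  rewrite !inE => /orP[/eqP->|/imfsetP[[z A] /=]].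
    by rewrite interleave_odd.
  by rewrite memL => /andP[_ /eqP zy] ->.
have uth : unifies th (u' |` [fset l.1 | l in L]).
  by move=> v v' /thy -> /thy ->.
have mguL := mguP uth; set sigma := mgu _ _ in mguL.
have [delta dE] := mguL.2 th uth.
have deltaE v : subst_tuple delta (subst_tuple sigma v) = subst_tuple th v.
  rewrite subst_tuple_comp; congr subst_tuple.
  by apply: functional_extensionality_dep => j; apply: funext => x.
have := fo_res dC dD even_renP erefl odd_renP erefl (@var_disjoint_ren C D)
  LC nL u'D mguL.
rewrite /fo_resolvent -/C' -/D'; set R := (X in normalize X) => dR.
exists R, delta, (fun j x => subst sigma (ro j x)); split=> //.
  by move=> v; rewrite -subst_tuple_comp deltaE interleave_odd.
move=> v X; rewrite !inE => /orP[/orP[/mem_subst_clause[z zC ->]|/eqP[-> ->]]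
  |/mem_subst_clause[z zD ->]].
- move: zC; rewrite !inE => /andP[nzL zC].
  have /mem_subst_clause[z0 z0C ez] := zC; subst z.
  move: nzL; rewrite zC /= interleave_even => /eqP ne.
  by apply: Or31; exists z0; rewrite deltaE interleave_even.
- apply: Or32; split; first by rewrite deltaE thy // fset1U1.
    apply: subset_trans (subsetIl _ _) _; apply/subsetP => w.
    move=> /mem_bigcup_seq[[z A] [zL _ /= wA]].
    move: zL; rewrite memL => /andP[/mem_subst_clause[z0 z0C ->]].
    rewrite interleave_even => /eqP z0y.
    apply/mem_merged/allows_subst; exists z0 => //; by exists A.
  exact: subsetIr.
- move: zD; rewrite !inE => /andP[nz /mem_subst_clause[z0 z0D ez]]; subst z.
  apply: Or33; exists z0; split=> //; last by rewrite -subst_tuple_comp.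
  by move=> [e1 e2]; subst z0 X; rewrite eqxx in nz.
Qed.

(** With [M] the values that the instance of [C] allows at [y], these literals are the ones that
    allow too much there. *)
Definition bad tau D (y : term_tuple Sg) (M : {set W}) :
    clause (term_tuple Sg) W :=
  [fset l in D | (subst_tuple tau l.1 == y) && ~~ (l.2 \subset M)].

(* Several literals of D may have the same instance y while the rule resolves
   only one literal of its right premise, so C is resolved repeatedly with the
   bad literals of D. *)
Lemma lift_ground_resolution C tau y :
  fo_derivable Phi C -> (exists v A, (v, A) \in C /\ subst_tuple tau v = y) ->
  forall D tau', fo_derivable Phi D ->
  exists E delta, [/\ fo_derivable Phi E,
    forall z w, z <> y -> allows (subst_clause delta E) z w ->
      allows (subst_clause tau C) z w \/ allows (subst_clause tau' D) z w &
    forall w, allows (subst_clause delta E) y w ->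
      allows (subst_clause tau C) y w /\ allows (subst_clause tau' D) y w].
Proof.
move=> dC Cy; set M := merged (subst_clause tau C) y.
suff gen n D tau' : fo_derivable Phi D -> #|` bad tau' D y M| <= n ->
  exists E delta, [/\ fo_derivable Phi E,
    forall z w, z <> y -> allows (subst_clause delta E) z w ->
      allows (subst_clause tau C) z w \/ allows (subst_clause tau' D) z w &
    forall w, allows (subst_clause delta E) y w ->
      allows (subst_clause tau C) y w /\ allows (subst_clause tau' D) y w].
  by move=> D tau' dD; exact: gen dD (leqnn _).
elim: n D tau' => [|n IH] D tau' dD.
  rewrite leqn0 cardfs_eq0 => /eqP bD; exists D, tau'; split=> // [z w _|w yw].
    by right.
  split=> //; apply/mem_merged.
  have /allows_subst[v [A vA wA] vy] := yw.
  apply: contraT => wM.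
  suff: (v, A) \in bad tau' D y M by rewrite bD inE.
  rewrite !inE vA /= -vy eqxx /=; apply: contra wM => /subsetP; exact.
have [b0|[[u B] uB]] := fset_0Vmem (bad tau' D y M).
  by move=> _; apply: IH; rewrite ?b0 ?cardfs0.
rewrite (cardfsD1 (u, B)) uB add1n ltnS => cn.
move: (uB); rewrite !inE => /and3P[uD /eqP uy nB].
have [R [delta [phi [dR dphi Rs]]]] := lift_resolution dC dD Cy uD uy.
have [|E [eps [dE Ez Ey]]] := IH _ delta dR.
  apply: leq_trans cn.
  (* The number of bad literals drops: a value outside [M] at [y] can only come from a bad literal
     of [D] other than [(u, B)], and [h] sends that one to the bad literal of [normalize R]. *)
  pose h (l : literal (term_tuple Sg) W) : literal (term_tuple Sg) W :=
    (subst_tuple phi l.1, merged R (subst_tuple phi l.1)).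
  apply: (@leq_trans #|` [fset h l | l in bad tau' D y M `\ (u, B)]|);
    last exact: leq_imfset_card.
  apply: fsubset_leq_card; apply/fsubsetP => -[v X].
  rewrite !inE /= => /and3P[/mem_normalize[-> _] /eqP vy /subsetPn[w]].
  move=> /mem_merged[X' vX wX] wM; case: (Rs v X' vX).
  - by move=> [v0 [_ ne e]]; case: ne; rewrite -e.
  - by move=> [_ /subsetP/(_ w wX)]; rewrite (negbTE wM).
  - move=> [v0 [v0D ne ev]]; apply/imfsetP.
    exists (v0, X'); rewrite /h /= -?ev //.
    rewrite !inE v0D /= -(dphi v0) -ev vy eqxx /=; apply/andP; split.
      exact/eqP.
    by apply/subsetPn; exists w.
have Rall z w : allows (subst_clause delta (normalize R)) z w ->
    (z <> y /\ allows (subst_clause tau C) z w) \/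
    allows (subst_clause tau' D) z w.
  move=> /allows_subst[v /allows_normalize[X vX wX] ->].
  case: (Rs v X vX).
  - move=> [v0 [v0C ne ->]]; left; split=> //.
    by apply/allows_subst; exists v0 => //; exists X.
  - move=> [-> _ /subsetP/(_ w wX) wB]; right; apply/allows_subst.
    by exists u => //; exists B.
  - move=> [v0 [v0D _ ->]]; right; rewrite dphi; apply/allows_subst.
    by exists v0 => //; exists X.
exists E, eps; split=> // [z w zy /(Ez _ _ zy)|w /Ey[Cw]].
  by move=> [|/Rall[[]|]]; auto.
by move=> /Rall[[]|]; auto.
Qed.

(* The terms, variables included, form the carriers of the model, so that
   valuations are substitutions. *)
Definition term_model (f : term_tuple Sg -> W) : outcome_model Sg W :=
  @OutcomeModel N Sg W (term Sg) (fun j => inhabits (Var Sg j 0))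
    (fun g args => App g args) f.

Lemma eval_term_model f (eta : valuation (term_model f)) j (t : term Sg j) :
  eval eta t = subst (eta : substitution Sg) t.
Proof.
elim: t => [//|g args IH] /=; congr App.
exact: functional_extensionality_dep.
Qed.

Lemma fo_satisfiable_iff_consistent (w0 : W) :
  fo_satisfiable Phi <-> fo_consistent Phi.
Proof.
split=> [[M sPhi] [C dC /blatantly_inconsistentP nC]|consPhi].
  have [eta _] := valuation_ex M.
  by have [v /nC] := (fo_sat_clauseP M C).1 (fo_sound sPhi dC) eta.
pose S E := exists C tau, fo_derivable Phi C /\ E = subst_clause tau C.
have [_ [C [tau [dC ->]]]|_ _ y [C [tau [dC ->]]] [D [tau' [dD ->]]]|f fS] :=
    @model_existence (term_tuple Sg) W S w0.
- move=> /blatantly_inconsistentP nC; apply: consPhi; exists C => //.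
  apply/blatantly_inconsistentP => y w yw.
  by apply: (nC (subst_tuple tau y) w); apply/allows_subst; exists y.
- have [Cy|nC] :=
      pselect (exists v A, (v, A) \in C /\ subst_tuple tau v = y).
    have [E [delta [dE Ez Ey]]] := lift_ground_resolution dC Cy tau' dD.
    by exists (subst_clause delta E); [exists E, delta|].
  (* Without a literal of instance [y], this clause serves as its own resolvent. *)
  exists (subst_clause tau C); first by exists C, tau.
  split=> [z w _|w /allows_subst[v [A vA _] vy]]; first by left.
  by case: nC; exists v, A.
- exists (term_model f) => C CPhi; apply/fo_sat_clauseP => eta.
  have [|y /allows_subst[v /allows_normalize vC ey]] :=
      fS (subst_clause (eta : substitution Sg) (normalize C)).
    by exists (normalize C), eta; split=> //; exact: fo_hyp.
  exists v; move: vC; rewrite ey /=; congr (allows C v (f _)).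
  by apply: functional_extensionality_dep => j; rewrite eval_term_model.
Qed.

End FirstOrder.

Theorem theorem15 (N W : finType) (W_nonempty : 0 < #|W|) :
  (forall (Y : choiceType) (Phi : clause_set Y W),
      prop_satisfiable Phi <-> prop_consistent Phi) /\
  (forall (Sg : signature N) (Phi : clause_set (term_tuple Sg) W),
      fo_satisfiable Phi <-> fo_consistent Phi).
Proof.
have /card_gt0P[w0 _] := W_nonempty.
split=> [Y|Sg] Phi.
  exact: prop_satisfiable_iff_consistent.
exact: fo_satisfiable_iff_consistent.
Qed.
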